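(* Let $K$ be a compact topological space. If $K$ is zero-dimensional, then $\gamma^*(C(K))=1$. Further, if $K$ is extremally disconnected, then $C(K)$ admits a lattice tiling by balls.
   Context: Compact spaces are Hausdorff and non-empty. $K$ is zero-dimensional if it has a basis consisting of clopen sets, and extremally disconnected if the closure of every open subset is open. $C(K)$ is the space of real-valued continuous functions on $K$ with the supremum norm. In a real normed space $X$, a set $P\subseteq X$ is $r$-separated if $\|x-y\|\ge r$ for all distinct $x,y\in P$, and $r$-dense if for every $x\in X$ there is $p\in P$ with $\|x-p\|\le r$. $\gamma^*(X)=\inf\{r>0:\text{there exists an }r\text{-dense and }2\text{-separated additive subgroup }P\subseteq X\}$. A lattice tiling of $X$ by balls is a family $\{B_X+\lambda\}_{\lambda\in\Lambda}$, where $B_X$ is the closed unit ball and $\Lambda$ is a discrete additive subgroup of $X$, whose members have pairwise disjoint interiors and cover $X$. *)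

(* Defs.v *)
From HB Require Import structures.
From mathcomp Require Import all_boot all_order all_algebra.
From mathcomp Require Import all_classical all_reals ereal topology normedtype.

Set Implicit Arguments.
Unset Strict Implicit.
Unset Printing Implicit Defensive.

Import Order.TTheory GRing.Theory Num.Theory.
Import numFieldNormedType.Exports.

Local Open Scope classical_set_scope.
Local Open Scope ring_scope.

Section Topology.
Context (K : topologicalType).

(* The library's [zero_dimensional] only asks that clopen sets separate points,
   hence the different name. *)
Definition has_clopen_basis :=
  exists2 B : set (set K), B `<=` clopen & basis B.

Definition extremally_disconnected :=
  forall U : set K, open U -> open (closure U).

End Topology.

(* C(K): the compactness proof is a parameter of the type because the
   supremum norm is only well behaved for compact K. *)
Definition cfun (R : realType) (K : topologicalType)
  (cK : compact [set: K]) : Type := continuousType K R.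

Section ContinuousFunctions.
Context (R : realType) (K : topologicalType) (cK : compact [set: K]).

HB.instance Definition _ := gen_eqMixin (cfun R cK).
HB.instance Definition _ := gen_choiceMixin (cfun R cK).

Implicit Types (f g h : cfun R cK) (a b : R) (x : K).

Let cts f : continuous (f : K -> R).
Proof. exact: cts_fun. Qed.

Let cst_cts a : continuous (fun _ : K => a).
Proof. by move=> x; exact: cvg_cst. Qed.

Let add_cts f g : continuous (fun x => f x + g x : R).
Proof. by move=> x; apply: cvgD; exact: cts. Qed.

Let opp_cts f : continuous (fun x => - f x : R).
Proof. by move=> x; apply: cvgN; exact: cts. Qed.

Let scale_cts a f : continuous (fun x => a * f x : R).
Proof. by move=> x; apply: cvgM; [exact: cvg_cst|exact: cts]. Qed.

Definition cfun_zero : cfun R cK := mkcts (@cst_cts 0).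
Definition cfun_add f g : cfun R cK := mkcts (@add_cts f g).
Definition cfun_opp f : cfun R cK := mkcts (@opp_cts f).
Definition cfun_scale a f : cfun R cK := mkcts (@scale_cts a f).

Lemma cfunP f g : (forall x, f x = g x) -> f = g.
Proof. by move=> fg; apply/continuousEP. Qed.

Fact cfun_addA : associative cfun_add.
Proof. by move=> f g h; apply: cfunP => x; exact: addrA. Qed.

Fact cfun_addC : commutative cfun_add.
Proof. by move=> f g; apply: cfunP => x; exact: addrC. Qed.

Fact cfun_add0 : left_id cfun_zero cfun_add.
Proof. by move=> f; apply: cfunP => x; exact: add0r. Qed.

Fact cfun_addN : left_inverse cfun_zero cfun_opp cfun_add.
Proof. by move=> f; apply: cfunP => x; exact: addNr. Qed.

HB.instance Definition _ := GRing.isZmodule.Build (cfun R cK)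
  cfun_addA cfun_addC cfun_add0 cfun_addN.

Fact cfun_scaleA a b f : cfun_scale a (cfun_scale b f) = cfun_scale (a * b) f.
Proof. by apply: cfunP => x; exact: mulrA. Qed.

Fact cfun_scale1 : left_id 1 cfun_scale.
Proof. by move=> f; apply: cfunP => x; exact: mul1r. Qed.

Fact cfun_scaleDr : right_distributive cfun_scale +%R.
Proof. by move=> a f g; apply: cfunP => x; exact: mulrDr. Qed.

Fact cfun_scaleDl f : {morph cfun_scale^~ f : a b / a + b}.
Proof. by move=> a b; apply: cfunP => x; exact: mulrDl. Qed.

HB.instance Definition _ := GRing.Zmodule_isLmodule.Build R (cfun R cK)
  cfun_scaleA cfun_scale1 cfun_scaleDr cfun_scaleDl.

Definition supnorm f : R := sup (range (fun x => `|f x|)).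

Lemma has_ubound_cfun f : has_ubound (range (fun x => `|f x|)).
Proof.
have : compact (range (fun x => `|f x|)).
  apply: continuous_compact cK; apply: continuous_subspaceT => x.
  by apply: cvg_norm; exact: cts.
by move=> /compact_bounded[M [_ MA]]; exists (M + 1) => y /MA My;
  rewrite (le_trans _ (My _ _)) ?ler_norm ?ltrDl.
Qed.

Lemma le_supnorm f x : `|f x| <= supnorm f.
Proof. by apply: ub_le_sup; [exact: has_ubound_cfun|exists x]. Qed.

Lemma supnorm_le f a : 0 <= a -> (forall x, `|f x| <= a) -> supnorm f <= a.
Proof.
move=> a0 fa; rewrite /supnorm.
have [->|/set0P E0] := eqVneq (range (fun x => `|f x|)) set0.
  by rewrite sup0.
by apply: ge_sup => // _ [x _ <-].
Qed.

Lemma supnorm_ge0 f : 0 <= supnorm f.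
Proof.
rewrite /supnorm.
have [->|/set0P[_ [x _ _]]] := eqVneq (range (fun x => `|f x|)) set0.
  by rewrite sup0.
exact: le_trans (normr_ge0 (f x)) (le_supnorm f x).
Qed.

Fact supnormD f g : supnorm (f + g) <= supnorm f + supnorm g.
Proof.
apply: supnorm_le => [|x]; first by rewrite addr_ge0 ?supnorm_ge0.
by rewrite (le_trans (ler_normD _ _))// lerD ?le_supnorm.
Qed.

Fact supnormZ a f : supnorm (a *: f) = `|a| * supnorm f.
Proof.
have le_scale b h : supnorm (b *: h) <= `|b| * supnorm h.
  apply: supnorm_le => [|x]; first by rewrite mulr_ge0 ?supnorm_ge0.
  by rewrite [leLHS]normrM ler_wpM2l ?le_supnorm.
apply/eqP; rewrite eq_le le_scale /=.
have [->|a0] := eqVneq a 0; first by rewrite normr0 mul0r supnorm_ge0.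
rewrite -ler_pdivlMl ?normr_gt0// -normfV.
by rewrite -[in leLHS](scalerK a0 f) le_scale.
Qed.

Fact supnorm0_eq0 f : supnorm f = 0 -> f = 0.
Proof.
move=> f0; apply: cfunP => x; apply/normr0_eq0/eqP.
by rewrite eq_le normr_ge0 andbT -f0 le_supnorm.
Qed.

HB.instance Definition _ := Lmodule_isNormed.Build R (cfun R cK)
  supnormD supnormZ supnorm0_eq0.

Lemma cfun_normE f : `|f| = sup (range (fun x => `|f x|)).
Proof. by []. Qed.

End ContinuousFunctions.

Section NormedSpace.
Context (R : realType) (X : normedModType R).
Implicit Types (P L : set X) (r : R).

Definition separated_by r P :=
  forall x y, P x -> P y -> x <> y -> r <= `|x - y|.

Definition dense_within r P := forall x, exists2 p, P p & `|x - p| <= r.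

Definition additive_subgroup P := P 0 /\ forall x y, P x -> P y -> P (x - y).

(* Valued in the extended reals so that the infimum of an empty set is +oo. *)
Definition gamma_star : \bar R :=
  ereal_inf [set r%:E | r in [set r | 0 < r /\
    exists P, [/\ additive_subgroup P, dense_within r P & separated_by 2 P]]].

Definition discrete_subgroup L := additive_subgroup L /\ L `<=` isolated L.

Definition unit_ball_translate (l : X) : set X :=
  [set b + l | b in closed_ball_ Num.norm (0 : X) 1].

Definition lattice_ball_tiling L :=
  [/\ discrete_subgroup L,
      trivIset L (fun l => (unit_ball_translate l)°) &
      \bigcup_(l in L) unit_ball_translate l = [set: X]].

Definition has_lattice_ball_tiling := exists L, lattice_ball_tiling L.

End NormedSpace.

Arguments gamma_star {R} X.
Arguments has_lattice_ball_tiling {R} X.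

(* Main.v *)
Require Import Defs.
From mathcomp Require Import all_boot all_order all_algebra lra.
From mathcomp Require Import all_classical all_reals ereal topology normedtype.

(** Both halves use the same subgroup P of C(K): the continuous functions with
values in the even integers. Two distinct members of P differ by at least 2 at
some point, so P is 2-separated, and everything comes down to how well a given
f can be approximated from P.

To approximate f within r, cover K by clopen sets A_n, one for each integer n,
with |f - 2n| <= r on A_n. Such a countable clopen cover can be refined to a
clopen partition ([clopen_cover_selection]), and the function equal to 2n on
the n-th piece lies in P ([even_valued_approximation]).

- If K has a clopen basis and r > 1, the compact set {|f - 2n| <= 1} lies in
  the open set {|f - 2n| < r}, and compactness yields a clopen set between the
  two ([clopen_between]). The sets {|f - 2n| <= 1} already cover K. So P is
  r-dense for each r > 1, whence gamma^* <= 1. Conversely, if a 2-separated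
  subgroup of a nonzero normed space is r-dense, then r >= 1: no point of the
  subgroup is at distance less than 1 from a unit vector
  ([separated_dense_ge1]).

- If K is extremally disconnected, V_n = closure {f < 2n + 1} is clopen, and
  A_n = V_n minus V_(n-1) works with r = 1. So P is 1-dense, that is, the
  translates of the unit ball by P cover C(K); being 2-separated, P is discrete
  and these balls have disjoint interiors
  ([dense_separated_lattice_tiling]). *)

Set Implicit Arguments.
Unset Strict Implicit.
Unset Printing Implicit Defensive.

Import Order.TTheory GRing.Theory Num.Theory.
Import numFieldNormedType.Exports.

Local Open Scope classical_set_scope.
Local Open Scope ring_scope.

(** * Separated and dense subgroups of normed spaces *)

Section NormedSpaces.
Context (R : realType) (X : normedModType R).
Implicit Types (P : set X) (r : R) (l u : X).

Lemma norm_interior_unit_ball_translate l u :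
  (unit_ball_translate l)° u -> `|u - l| < 1.
Proof.
have -> : unit_ball_translate l = closed_ball l (1 : R).
  rewrite closed_ballE//; apply/seteqP; split => [_ [b + <-]|v].
    by rewrite /closed_ball_/= sub0r opprD addrA addrAC subrr sub0r.
  rewrite /closed_ball_/= distrC => vl.
  by exists (v - l); rewrite ?subrK// /closed_ball_/= sub0r normrN.
by rewrite interior_closed_ballE// -ball_normE/= distrC.
Qed.

(** A common interior point would be at distance less than 1 from both centres,
which are at distance at least 2. *)
Lemma separated_trivIset_ball_interiors P :
  separated_by 2 P -> trivIset P (fun l => (unit_ball_translate l)°).
Proof.
move=> sepP l m Pl Pm [u [/norm_interior_unit_ball_translate ul]].
move=> /norm_interior_unit_ball_translate um.
apply: contrapT => /(sepP l m Pl Pm); apply/negP; rewrite -ltNge.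
have -> : l - m = (u - m) - (u - l) by rewrite opprB [RHS]addrC addrA subrK.
by rewrite (le_lt_trans (ler_normB _ _))//; lra.
Qed.

Lemma separated_isolated r P : 0 < r -> separated_by r P -> P `<=` isolated P.
Proof.
move=> r0 sepP l Pl; split; first exact/mem_set.
exists (ball l r); first exact: nbhsx_ballx.
apply/seteqP; split => [m [lm Pm]|_ ->]; last by split=> //; exact: ballxx.
apply/esym; apply: contrapT => /(sepP l m Pl Pm); apply/negP; rewrite -ltNge.
by move: lm; rewrite -ball_normE.
Qed.

Lemma dense_separated_lattice_tiling P : additive_subgroup P ->
  dense_within 1 P -> separated_by 2 P -> lattice_ball_tiling P.
Proof.
move=> subP denP sepP; split.
- split=> //; exact: separated_isolated sepP.
- exact: separated_trivIset_ball_interiors.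
- apply/seteqP; split=> // u _; have [p Pp up] := denP u.
  exists p => //; exists (u - p); last by rewrite subrK.
  by rewrite /closed_ball_/= sub0r normrN.
Qed.

(** The unit vector u is at distance 1 from 0, and at distance at least
2 - 1 = 1 from every other point of P, whose norm is at least 2 as P contains
0. *)
Lemma separated_dense_ge1 P r u : `|u| = 1 -> P 0 ->
  dense_within r P -> separated_by 2 P -> 1 <= r.
Proof.
move=> u1 P0 denP sepP; have [p Pp up] := denP u.
have [p0|/eqP p0] := eqVneq p 0; first by rewrite -u1 -[u]subr0 -p0.
have := sepP p 0 Pp P0 p0; rewrite subr0 => p2.
have := lerB_dist p u; rewrite distrC; lra.
Qed.

Lemma gamma_star_eq1 P u : `|u| = 1 -> additive_subgroup P ->
  separated_by 2 P -> (forall r, 1 < r -> dense_within r P) ->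
  gamma_star X = 1%:E.
Proof.
move=> u1 subP sepP denP; apply/eqP; rewrite eq_le; apply/andP; split.
  apply/lee_addgt0Pr => e e0; rewrite -EFinD; apply: ereal_inf_lbound.
  exists (1 + e) => //; split; first by rewrite addr_gt0.
  by exists P; split=> //; apply: denP; rewrite ltrDl.
apply: le_ereal_inf_tmp => _ [r [_ [Q [[Q0 _] denQ sepQ]]] <-].
by rewrite lee_fin; exact: separated_dense_ge1 u1 Q0 denQ sepQ.
Qed.

End NormedSpaces.

(** * Clopen sets: countable covers and interpolation *)

Section ClopenSets.
Context (K : topologicalType).
Implicit Types (x : K).

Lemma clopen_locally_constant (A : set K) x :
  clopen A -> \forall y \near x, A y <-> A x.
Proof.
move=> [oA cA]; have [Ax|nAx] := pselect (A x).
  have : nbhs x A by exact: open_nbhs_nbhs.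
  by apply: filterS => y Ay; split.
have : nbhs x (~` A) by apply: open_nbhs_nbhs; split=> //; exact: closed_openC.
by apply: filterS => y nAy; split.
Qed.

(** Sending x to the first i, in the enumeration of I, such that A i contains x
is locally constant, because membership in each of the finitely many clopen
sets up to that index is. *)
Lemma clopen_cover_selection (I : countType) (A : I -> set K) :
  (forall i, clopen (A i)) -> (forall x, exists i, A i x) ->
  exists2 g : K -> I, forall x, A (g x) x &
    forall x, \forall y \near x, g y = g x.
Proof.
move=> cA covA.
have minA x : exists i, A i x /\ forall j, A j x -> (pickle i <= pickle j)%N.
  pose Q n := `[< exists2 i, A i x & pickle i = n >].
  have exQ : exists n, Q n.
    by have [i Aix] := covA x; exists (pickle i); apply/asboolP; exists i.
  case: (ex_minnP exQ) => _ /asboolP[i Aix <-] mini; exists i; split=> // j Ajx.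
  by apply: mini; apply/asboolP; exists j.
have [g gP] := choice minA.
exists g => [x|x]; first by have [] := gP x.
(* only finitely many i have a code below n, so the neighbourhoods on which
   the membership in A i is constant can be intersected *)
have locA n : \forall y \near x, forall j, (pickle j < n)%N -> A j y <-> A j x.
  elim: n => [|n IH]; first by apply: nearW.
  have [[i iE]|nE] := pselect (exists i : I, pickle i = n); last first.
    apply: filterS IH => y IH j; rewrite ltnS leq_eqVlt => /predU1P[jn|/IH//].
    by case: nE; exists j.
  apply: filterS2 (clopen_locally_constant x (cA i)) IH => y Ai IH j.
  rewrite ltnS leq_eqVlt => /predU1P[|/IH//].
  by rewrite -iE => /(pcan_inj pickleK) ->.
apply: filterS (locA (pickle (g x)).+1) => y Ay.
have [Agx gx] := gP x; have [Agy gy] := gP y.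
have yx : (pickle (g y) <= pickle (g x))%N by apply: gy; apply/Ay.
apply: (pcan_inj pickleK); apply/eqP; rewrite eqn_leq yx/=.
by apply: gx; apply/Ay.
Qed.

(** If no clopen D inside U contained C, the sets C minus D would be nonempty;
they are stable under finite intersection, as the union of two such D is again
one, so they would generate a proper filter, with a cluster point x in C. But a
basic clopen neighbourhood of x inside U is one of the sets D, and it does not
meet C minus D. *)
Lemma clopen_between (C U : set K) : has_clopen_basis K -> compact C ->
  open U -> C `<=` U -> exists D, [/\ clopen D, C `<=` D & D `<=` U].
Proof.
move=> [B Bclopen [_ basisB]] cC oU CU.
pose S := [set D : set K | clopen D /\ D `<=` U].
pose F := filter_from S (fun D => C `\` D).
have [[D [cD DU] CD0]|nS] := pselect (exists2 D, S D & C `\` D = set0).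
  by exists D; split=> //; rewrite -setD_eq0.
have FF : ProperFilter F.
  apply: filter_from_proper; last first.
    by move=> D SD; apply/set0P/negP => /eqP CD0; apply: nS; exists D.
  apply: filter_from_filter; first by exists set0; split=> //; exact: clopen0.
  move=> D E [cD DU] [cE EU]; exists (D `|` E); last by rewrite setDUr.
  by split; [exact: clopenU|rewrite subUset].
have FC : F C by exists set0; rewrite ?setD0//; split=> //; exact: clopen0.
have [x [Cx clx]] := cC F FF FC.
have : nbhs x U by apply: open_nbhs_nbhs; split=> //; exact: CU.
move=> /basisB[D [BD Dx] DU].
have cD : clopen D by exact: Bclopen.
have FD : F (C `\` D) by exists D.
have [y [[_ nDy] Dy]] := clx _ _ FD (open_nbhs_nbhs (conj cD.1 Dx)).
by [].
Qed.

End ClopenSets.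

(** * Approximation by even-integer-valued functions *)

Section EvenValuedFunctions.
Context (R : realType) (K : topologicalType) (cK : compact [set: K]).
Implicit Types (f p : cfun R cK) (r : R) (x : K).

Definition even_valued : set (cfun R cK) :=
  [set f : cfun R cK | forall x, exists n : int, f x = 2 * n%:~R].

Lemma additive_subgroup_even_valued : additive_subgroup even_valued.
Proof.
split=> [x|f p fP pP x]; first by exists 0; rewrite mulr0.
have [m fm] := fP x; have [n pn] := pP x; exists (m - n).
by rewrite [LHS](_ : _ = f x - p x)// fm pn -mulrBr intrB.
Qed.

Lemma separated_even_valued : separated_by 2 even_valued.
Proof.
move=> f p fP pP fp.
have [x fpx] : exists x, f x <> p x.
  apply: contrapT => /forallNP h; apply: fp; apply: cfunP => x.
  exact: contrapT.
apply: le_trans (le_supnorm _ x); rewrite [X in `|X|](_ : _ = f x - p x)//.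
have [m fm] := fP x; have [n pn] := pP x; move: fpx; rewrite fm pn.
rewrite -mulrBr -intrB normrM ger0_norm// => mn.
rewrite ler_peMr// -intr_norm ler1z -gtz0_ge1 normr_gt0 subr_eq0.
by apply: contra_notN mn => /eqP ->.
Qed.

Lemma even_valued_approximation f r (A : int -> set K) : 0 <= r ->
  (forall n, clopen (A n)) -> (forall x, exists n, A n x) ->
  (forall n x, A n x -> `|f x - 2 * n%:~R| <= r) ->
  exists2 p, even_valued p & `|f - p| <= r.
Proof.
move=> r0 cA covA fA; have [g gA gloc] := clopen_cover_selection cA covA.
have gcts : continuous (fun x => 2 * (g x)%:~R : R).
  by move=> x; apply: cvg_near_cst; apply: filterS (gloc x) => y ->.
exists (mkcts gcts : cfun R cK); first by move=> x; exists (g x).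
by apply: supnorm_le => // x; apply: fA.
Qed.

Lemma round_even (t : R) :
  exists n : int, 2 * n%:~R - 1 <= t < 2 * n%:~R + 1.
Proof.
exists (Num.floor ((t + 1) / 2)); move: (floor_itv ((t + 1) / 2)).
by rewrite intrD => /andP[? ?]; apply/andP; split; lra.
Qed.

(** The strict inequality 1 < r leaves room for a clopen set between
{|f - 2n| <= 1} and {|f - 2n| < r}. *)
Lemma dense_even_valued_zero_dimensional r :
  has_clopen_basis K -> 1 < r -> dense_within r even_valued.
Proof.
move=> hB r1 f; have fcts : continuous (f : K -> R) by exact: cts_fun.
have sepA (n : int) : exists D, [/\ clopen D,
    f @^-1` closed_ball (2 * n%:~R : R) 1 `<=` D &
    D `<=` f @^-1` ball (2 * n%:~R : R) r].
  apply: clopen_between => //.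
  - apply: subclosed_compact cK _ => //.
    apply: preimage_closed; [by move=> x _; exact: fcts|].
    exact: closed_ball_closed.
  - by apply: open_comp; [move=> x _; exact: fcts|exact: ball_open].
  - move=> x; rewrite /preimage/= closed_ballE// -ball_normE/=.
    by move=> /le_lt_trans; apply.
have [A AP] := choice sepA.
apply: (@even_valued_approximation f r A); first lra.
- by move=> n; have [] := AP n.
- move=> x; have [n /andP[fn1 fn2]] := round_even (f x); exists n.
  have [_ + _] := AP n; apply.
  rewrite /preimage/= closed_ballE// /closed_ball_/=.
  by rewrite ler_norml; apply/andP; split; lra.
- move=> n x Anx; have [_ _ /(_ _ Anx)] := AP n.
  by rewrite /preimage/= -ball_normE/= distrC => /ltW.
Qed.

(** The closure V_n of {f < 2n + 1} is clopen, and f is at most 2n + 1 on it and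
at least 2n + 1 off it. So |f - 2n| <= 1 on V_n minus V_(n-1), with no loss:
at the points where f = 2n + 1, where both 2n and 2n + 2 are admissible, it is
V_n that chooses between them in a locally constant way. *)
Lemma dense_even_valued_extremally_disconnected :
  extremally_disconnected K -> dense_within 1 even_valued.
Proof.
move=> edK f; have fcts : continuous (f : K -> R) by exact: cts_fun.
pose c (n : int) : R := 2 * n%:~R + 1.
pose V n := closure (f @^-1` [set t | t < c n]).
have cV n : clopen (V n).
  split; last exact: closed_closure.
  apply: edK; apply: open_comp; [by move=> x _; exact: fcts|exact: open_lt].
have ltV n x : f x < c n -> V n x by move=> fx; apply: subset_closure.
have leV n x : V n x -> f x <= c n.
  have cle : closed (f @^-1` [set t | t <= c n]).
    by apply: preimage_closed; [move=> y _; exact: fcts|exact: closed_le].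
  move=> Vnx; have := (closure_id _).1 cle; rewrite predeqE => /(_ x)[_]; apply.
  by apply: closureS Vnx => y /ltW.
have cE n : c (n - 1) = 2 * n%:~R - 1 by rewrite /c intrB; lra.
apply: (@even_valued_approximation f 1 (fun n => V n `\` V (n - 1))) => //.
- by move=> n; rewrite setDE; apply: clopenI => //; exact: (clopenC set0).
- move=> x; have [n /andP[fn1 fn2]] := round_even (f x).
  have Vnx : V n x by exact: ltV.
  (* if x already lies in V (n - 1), then f x = 2n - 1, so that x cannot lie
     in V (n - 2) *)
  have [Vn1x|nVn1x] := pselect (V (n - 1) x); last by exists n.
  exists (n - 1); split=> // /leV; rewrite cE intrB => fn3; lra.
- move=> n x [/leV fx nVx]; rewrite ler_norml; rewrite /c in fx.
  have : c (n - 1) <= f x by rewrite leNgt; apply/negP => /ltV.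
  by rewrite cE => fx'; apply/andP; split; lra.
Qed.

End EvenValuedFunctions.

(** * Compact zero-dimensional and extremally disconnected spaces *)

Theorem theorem4p4 (R : realType) (K : topologicalType)
    (cK : compact [set: K]) (hK : hausdorff_space K) (K0 : [set: K] !=set0) :
  (has_clopen_basis K -> gamma_star (cfun R cK) = 1%:E) /\
  (extremally_disconnected K -> has_lattice_ball_tiling (cfun R cK)).
Proof.
have subP := additive_subgroup_even_valued R cK.
have sepP := @separated_even_valued R K cK.
split=> [zK|edK]; last first.
  exists (@even_valued R K cK); apply: dense_separated_lattice_tiling => //.
  exact: dense_even_valued_extremally_disconnected.
have ctsu : continuous (fun _ : K => 1 : R) by move=> x; exact: cvg_cst.
pose u : cfun R cK := mkcts ctsu.
have u1 : `|u| = 1.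
  have [x _] := K0; apply/eqP; rewrite eq_le; apply/andP; split.
    by apply: supnorm_le => // y; rewrite normr1.
  by have := le_supnorm u x; rewrite [u x]/= normr1.
apply: (gamma_star_eq1 u1 subP sepP) => r.
exact: dense_even_valued_zero_dimensional.
Qed.
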